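(* Let $(\mathcal{E},\otimes)$ be a locally subcartesian closed category. Any commuting square $f\circ g'=g\circ f'$ with $f'\colon C\to B$, $g'\colon C\to A$, $g\colon B\to T$, $f\colon A\to T$ which factors through the chosen subpullback of $f$ and $g$ gives rise to a natural transformation $$\mathfrak{t}\colon\Delta_g\boxtimes_f\Rightarrow\boxtimes_{f'}\Delta_{g'}\colon\mathcal{E}/A\to\mathcal{E}/B,$$ and this transformation is invertible if and only if the square is a subpullback.
   Context: A commuting square $fg'=gf'$ on a cospan $f\colon A\to X$, $g\colon B\to X$ is subcartesian if the pair $(g',f')$ is jointly monic. A locally subcartesian category $(\mathcal{E},\otimes)$ is a category $\mathcal{E}$ with, for each cospan $f\colon A\to X$, $g\colon B\to X$, a chosen subcartesian square (the chosen subpullback) with apex $A\otimes_X B$ and projections $g'\colon A\otimes_X B\to A$, $f'\colon A\otimes_X B\to B$, subject to: (symmetry) there are isomorphisms $A\otimes_X B\cong B\otimes_X A$ commuting with the projections; (nullary) if $g$ is an identity then so is $g'$; (binary) for $p\colon W\to Y$, $q\colon Y\to Z$, $g\colon B\to Z$, with $g'\colon Y\otimes_Z B\to Y$, pasting the chosen square of $(p,g')$ with the chosen square of $(q,g)$ gives a square isomorphic, compatibly with the projections to $W$ and $B$, to the chosen square of $(qp,g)$. A commuting square is called a subpullback if it is isomorphic, compatibly with projections, to the chosen square of its cospan. For $f\colon X\to Y$: $\Sigma_f\colon\mathcal{E}/X\to\mathcal{E}/Y$ is composition with $f$; $\Delta_f$ is pullback along $f$; $\nabla_f\colon\mathcal{E}/Y\to\mathcal{E}/X$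 sends $h\colon H\to Y$ to the projection $X\otimes_Y H\to X$ (and acts on morphisms by the unique maps compatible with projections). Each slice $\mathcal{E}/X$ is monoidal with $f\otimes_X g=\Sigma_g\nabla_g(f)$. $(\mathcal{E},\otimes)$ is locally subcartesian closed if $\mathcal{E}$ has pullbacks and each of these monoidal structures is right closed; equivalently every $\nabla_p$ has a right adjoint $\boxtimes_p$. The transformation $\mathfrak{t}$ is the mate (under $\Sigma\dashv\Delta$ and $\nabla\dashv\boxtimes$) of the canonical transformation $\mathfrak{b}\colon\Sigma_{g'}\nabla_{f'}\Rightarrow\nabla_f\Sigma_g$, whose component at $h\colon M\to B$ is the unique morphism $C\otimes_B M\to A\otimes_T M$ commuting with the maps to $A$ and to $M$. *)

(* Defs.v *)
From Corelib Require Import ssreflect.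
From Stdlib Require Import ClassicalEpsilon.

Set Implicit Arguments.
Unset Strict Implicit.
Unset Printing Implicit Defensive.

Declare Scope cat_scope.
Delimit Scope cat_scope with cat.
Local Open Scope cat_scope.

Record category := Category {
  ob :> Type;
  hom : ob -> ob -> Type;
  idm : forall A, hom A A;
  comp : forall A B C, hom B C -> hom A B -> hom A C;
  comp1m : forall A B (f : hom A B), comp (idm B) f = f;
  compm1 : forall A B (f : hom A B), comp f (idm A) = f;
  compA : forall A B C D (h : hom C D) (g : hom B C) (f : hom A B),
    comp h (comp g f) = comp (comp h g) f }.

Arguments hom {c} A B.
Arguments idm {c} A.

Notation "g ∘ f" := (comp g f) (at level 40, left associativity) : cat_scope.

Definition is_iso (E : category) (A B : E) (f : hom A B) : Prop :=
  exists g : hom B A, g ∘ f = idm A /\ f ∘ g = idm B.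

(* "f is an identity" includes the equality of its domain and codomain. *)
Inductive is_identity (E : category) : forall A B : E, hom A B -> Prop :=
  is_identity_idm (A : E) : is_identity (idm A).

Record functor (C D : category) := Functor {
  fob :> C -> D;
  fmap : forall A B, hom A B -> hom (fob A) (fob B);
  fmap1 : forall A, fmap (idm A) = idm (fob A);
  fmapM : forall A B K (g : hom B K) (f : hom A B),
    fmap (g ∘ f) = fmap g ∘ fmap f }.

Definition fcomp (C D K : category) (G : functor D K) (F : functor C D) :
  functor C K.
Proof.
refine (@Functor C K (fun A => G (F A)) (fun A B f => fmap G (fmap F f)) _ _).
- by move=> A; rewrite !fmap1.
- by move=> *; rewrite !fmapM.
Defined.

Notation "G ⊚ F" := (fcomp G F) (at level 40, left associativity) : cat_scope.

Record nat_trans (C D : category) (F G : functor C D) := NatTrans {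
  nt :> forall A : C, hom (F A) (G A);
  nt_natural : forall A B (f : hom A B), fmap G f ∘ nt A = nt B ∘ fmap F f }.

Definition invertible (C D : category) (F G : functor C D)
    (t : nat_trans F G) : Prop :=
  exists s : nat_trans G F,
    forall A, s A ∘ t A = idm (F A) /\ t A ∘ s A = idm (G A).

Record adjunction (C D : category) (L : functor C D) (R : functor D C) :=
  Adjunction {
  unit : forall c : C, hom c (R (L c));
  unit_natural : forall c c' (f : hom c c'),
    fmap R (fmap L f) ∘ unit c = unit c' ∘ f;
  counit : forall d : D, hom (L (R d)) d;
  counit_natural : forall d d' (f : hom d d'),
    f ∘ counit d = counit d' ∘ fmap L (fmap R f);
  triangle_l : forall c, counit (L c) ∘ fmap L (unit c) = idm (L c);
  triangle_r : forall d, fmap R (counit d) ∘ unit (R d) = idm (R d) }.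

Record right_adjoint (C D : category) (L : functor C D) := RightAdjoint {
  radj :> functor D C;
  radjP : adjunction L radj }.

Definition adj_comp (C D K : category) (L : functor C D) (R : functor D C)
    (L' : functor D K) (R' : functor K D)
    (a : adjunction L R) (a' : adjunction L' R') :
  adjunction (L' ⊚ L) (R ⊚ R').
Proof.
refine (@Adjunction _ _ (L' ⊚ L) (R ⊚ R')
  (fun c => fmap R (unit a' (L c)) ∘ unit a c) _
  (fun d => counit a' d ∘ fmap L' (counit a (R' d))) _ _ _) => /=.
- move=> c c' f.
  by rewrite compA -fmapM unit_natural fmapM -compA unit_natural compA.
- move=> d d' f.
  by rewrite compA counit_natural -!compA -!fmapM counit_natural.
- move=> c.
  rewrite -compA -fmapM (fmapM L) (compA (counit _ _)) -counit_natural -compA.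
  by rewrite triangle_l compm1 triangle_l.
- move=> d.
  rewrite compA -fmapM (fmapM R') -(compA _ _ (unit _ _)).
  by rewrite unit_natural compA triangle_r comp1m triangle_r.
Defined.

Definition the (T : Type) (P : T -> Prop) (H : exists! x, P x) : T :=
  proj1_sig (constructive_indefinite_description _ H).

Lemma theP (T : Type) (P : T -> Prop) (H : exists! x, P x) : P (the H).
Proof. exact: (proj1 (proj2_sig (constructive_indefinite_description _ H))). Qed.

Lemma the_eq (T : Type) (P : T -> Prop) (H : exists! x, P x) (y : T) :
  P y -> y = the H.
Proof.
move=> Py; symmetry.
exact: (proj2 (proj2_sig (constructive_indefinite_description _ H)) y Py).
Qed.

Section UniversalArrows.
Variables (C D : category) (L : functor C D).
Variables (R : D -> C) (e : forall d, hom (L (R d)) d).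
Hypothesis univ : forall c d (k : hom (L c) d),
  exists! m : hom c (R d), e d ∘ fmap L m = k.

Definition transpose c d (k : hom (L c) d) : hom c (R d) := the (univ k).

Lemma transposeP c d (k : hom (L c) d) : e d ∘ fmap L (transpose k) = k.
Proof. exact: (theP (univ k)). Qed.

Lemma transpose_eq c d (k : hom (L c) d) m :
  e d ∘ fmap L m = k -> m = transpose k.
Proof. exact: the_eq. Qed.

Definition univ_functor : functor D C.
Proof.
refine (@Functor D C R (fun d d' f => transpose (f ∘ e d)) _ _).
- by move=> A; symmetry; apply: transpose_eq; rewrite fmap1 compm1 comp1m.
- move=> A B K g f; symmetry; apply: transpose_eq.
  by rewrite fmapM compA transposeP -!compA transposeP.
Defined.

Definition univ_right_adjoint : right_adjoint L.
Proof.
refine (@RightAdjoint _ _ L univ_functor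
  (@Adjunction _ _ L univ_functor
     (fun c => transpose (idm (L c))) _ e _ _ _)) => /=.
- move=> c c' f; transitivity (transpose (fmap L f)).
  + by apply: transpose_eq; rewrite fmapM compA transposeP -compA transposeP compm1.
  + by symmetry; apply: transpose_eq; rewrite fmapM compA transposeP comp1m.
- by move=> d d' f; rewrite transposeP.
- by move=> c; exact: transposeP.
- move=> d; transitivity (transpose (e d)).
  + by apply: transpose_eq; rewrite fmapM compA transposeP -compA transposeP compm1.
  + by symmetry; apply: transpose_eq; rewrite fmap1 compm1.
Defined.
End UniversalArrows.

(* Given b : L' => L, the corresponding R => R' between the right adjoints. *)
Definition mate (C D : category) (L L' : functor C D) (R R' : functor D C)
    (a : adjunction L R) (a' : adjunction L' R') (b : nat_trans L' L) :
  nat_trans R R'.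
Proof.
refine (@NatTrans _ _ R R'
  (fun d => fmap R' (counit a d) ∘ (fmap R' (b (R d)) ∘ unit a' (R d))) _).
move=> d d' f.
rewrite compA -fmapM counit_natural fmapM -!compA; congr (_ ∘ _).
by rewrite -unit_natural !compA -!fmapM nt_natural.
Defined.

Record slice_ob (E : category) (X : E) := SliceOb {
  dom : E;
  arr : hom dom X }.

Record slice_hom (E : category) (X : E) (h k : slice_ob X) := SliceHom {
  shom :> hom (dom h) (dom k);
  shomP : arr k ∘ shom = arr h }.

Lemma slice_hom_eq (E : category) (X : E) (h k : slice_ob X)
  (m n : slice_hom h k) : shom m = shom n -> m = n.
Proof.
case: m => m Pm; case: n => n Pn /= e; subst n.
by rewrite (proof_irrelevance _ Pm Pn).
Qed.

Lemma slice_comp_subproof (E : category) (X : E) (h k l : slice_ob X)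
    (n : slice_hom k l) (m : slice_hom h k) :
  arr l ∘ (shom n ∘ shom m) = arr h.
Proof. by rewrite compA !shomP. Qed.

Definition slice (E : category) (X : E) : category.
Proof.
refine (@Category (slice_ob X) (@slice_hom E X)
  (fun h => @SliceHom _ _ h h (idm (dom h)) (compm1 _))
  (fun h k l n m => @SliceHom _ _ h l (shom n ∘ shom m)
                        (slice_comp_subproof n m)) _ _ _).
- by move=> *; apply: slice_hom_eq; rewrite /= comp1m.
- by move=> *; apply: slice_hom_eq; rewrite /= compm1.
- by move=> *; apply: slice_hom_eq; rewrite /= compA.
Defined.

Lemma Sigma_subproof (E : category) (X Y : E) (f : hom X Y) (h k : slice X)
    (m : hom h k) :
  (f ∘ arr k) ∘ shom m = f ∘ arr h.
Proof. by rewrite -compA shomP. Qed.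

Definition Sigma (E : category) (X Y : E) (f : hom X Y) :
  functor (slice X) (slice Y).
Proof.
refine (@Functor (slice X) (slice Y) (fun h => SliceOb (f ∘ arr h))
  (fun h k m => @SliceHom _ _ (SliceOb (f ∘ arr h)) (SliceOb (f ∘ arr k))
                  (shom m) (Sigma_subproof f m)) _ _).
- by move=> h; apply: slice_hom_eq.
- by move=> h k l n m; apply: slice_hom_eq.
Defined.

Record square (E : category) (A B X : E) (f : hom A X) (g : hom B X) := Square {
  apex : E;
  pr1 : hom apex A;
  pr2 : hom apex B;
  squareP : f ∘ pr1 = g ∘ pr2 }.

Section Squares.
Variable E : category.

Definition jointly_monic (P A B : E) (u : hom P A) (v : hom P B) : Prop :=
  forall (W : E) (m n : hom W P), u ∘ m = u ∘ n -> v ∘ m = v ∘ n -> m = n.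

Definition subcartesian (A B X : E) (f : hom A X) (g : hom B X)
  (s : square f g) : Prop := jointly_monic (pr1 s) (pr2 s).

Definition square_map (A B X : E) (f : hom A X) (g : hom B X)
    (s t : square f g) (u : hom (apex s) (apex t)) : Prop :=
  pr1 t ∘ u = pr1 s /\ pr2 t ∘ u = pr2 s.

Arguments square_map {A B X f g} s t u.

Definition factors_through (A B X : E) (f : hom A X) (g : hom B X)
  (s t : square f g) : Prop := exists u, square_map s t u.

Definition square_iso (A B X : E) (f : hom A X) (g : hom B X)
  (s t : square f g) : Prop := exists u, is_iso u /\ square_map s t u.

Definition is_pullback (A B X : E) (f : hom A X) (g : hom B X)
  (s : square f g) : Prop := forall t, exists! u, square_map t s u.

Definition flip (A B X : E) (f : hom A X) (g : hom B X) (s : square f g) :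
  square g f := Square (eq_sym (squareP s)).

Lemma paste_subproof (W Y Z B : E) (p : hom W Y) (q : hom Y Z) (g : hom B Z)
    (s : square q g) (t : square p (pr1 s)) :
  (q ∘ p) ∘ pr1 t = g ∘ (pr2 s ∘ pr2 t).
Proof. by rewrite -compA squareP !compA squareP. Qed.

Definition paste (W Y Z B : E) (p : hom W Y) (q : hom Y Z) (g : hom B Z)
    (s : square q g) (t : square p (pr1 s)) : square (q ∘ p) g :=
  Square (paste_subproof t).

End Squares.

(* [chosen S f g] is the chosen subpullback of the cospan (f : A -> X, g : B -> X):
   its apex is A ⊗_X B, with projections [pr1] to A and [pr2] to B. *)
Record locally_subcartesian (E : category) := LocallySubcartesian {
  chosen : forall (A B X : E) (f : hom A X) (g : hom B X), square f g;
  chosen_subcartesian : forall (A B X : E) (f : hom A X) (g : hom B X),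
    subcartesian (chosen f g);
  chosen_symmetry : forall (A B X : E) (f : hom A X) (g : hom B X),
    square_iso (chosen f g) (flip (chosen g f));
  chosen_nullary : forall (A B X : E) (f : hom A X) (g : hom B X),
    is_identity g -> is_identity (pr1 (chosen f g));
  chosen_binary : forall (W Y Z B : E) (p : hom W Y) (q : hom Y Z) (g : hom B Z),
    square_iso (paste (chosen p (pr1 (chosen q g)))) (chosen (q ∘ p) g) }.

Section LocallySubcartesian.
Variables (E : category) (S : locally_subcartesian E).

Definition is_subpullback (A B X : E) (f : hom A X) (g : hom B X)
  (s : square f g) : Prop := square_iso s (chosen S f g).

Lemma nabla_map_ex (X Y : E) (f : hom X Y) (h k : slice Y) (m : hom h k) :
  exists! n : hom (apex (chosen S f (arr h))) (apex (chosen S f (arr k))),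
    pr1 (chosen S f (arr k)) ∘ n = pr1 (chosen S f (arr h)) /\
    pr2 (chosen S f (arr k)) ∘ n = shom m ∘ pr2 (chosen S f (arr h)).
Proof.
case: h m => H h [] /= m e; subst h.
have [s1 [_ [/= s11 s12]]] := chosen_symmetry S f (arr k ∘ m).
have [i [[j [_ ij]] [/= i1 i2]]] := chosen_binary S m (arr k) f.
have [s2 [_ [/= s21 s22]]] := chosen_symmetry S (arr k) f.
have N1 : pr1 (chosen S f (arr k)) ∘ (s2 ∘ (pr2 (chosen S m (pr1 (chosen S (arr k) f))) ∘ (j ∘ s1)))
   = pr1 (chosen S f (arr k ∘ m)).
  rewrite !compA s22 -i2 -!compA (compA i) ij comp1m.
  exact: s11.
have N2 : pr2 (chosen S f (arr k)) ∘ (s2 ∘ (pr2 (chosen S m (pr1 (chosen S (arr k) f))) ∘ (j ∘ s1)))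
   = m ∘ pr2 (chosen S f (arr k ∘ m)).
  rewrite !compA s21 -squareP -i1 -!compA (compA i) ij comp1m.
  by rewrite s12.
eexists; split; first by split; [exact: N1 | exact: N2].
move=> n [n1 n2]; apply: (chosen_subcartesian (l := S)).
- by rewrite N1 n1.
- by rewrite N2 n2.
Qed.

(* On h : H -> Y this is the projection X ⊗_Y H -> X; on morphisms it is the
   unique map compatible with both projections, extracted by [the]. *)
Definition nabla (X Y : E) (f : hom X Y) : functor (slice Y) (slice X).
Proof.
refine (@Functor (slice Y) (slice X)
  (fun h => SliceOb (pr1 (chosen S f (arr h))))
  (fun h k m => @SliceHom _ _ (SliceOb (pr1 (chosen S f (arr h))))
                  (SliceOb (pr1 (chosen S f (arr k))))
                  (the (nabla_map_ex f m))
                  (proj1 (theP (nabla_map_ex f m)))) _ _).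
- move=> h; apply: slice_hom_eq; symmetry; apply: the_eq.
  by rewrite /= !compm1 comp1m.
- move=> h k l n m; apply: slice_hom_eq; symmetry; apply: the_eq => /=.
  have [n1 n2] := theP (nabla_map_ex f n).
  have [m1 m2] := theP (nabla_map_ex f m).
  by split; rewrite compA ?n1 ?n2 // -!compA m2.
Defined.

(* The functor (- ⊗_X g), for the monoidal structure f ⊗_X g = Σ_g ∇_g f on the
   slice over X; right closedness involves only these functors, not the unit
   and associativity constraints (which are unique, by joint monicity). *)
Definition tensor_functor (X : E) (g : slice X) : functor (slice X) (slice X) :=
  Sigma (arr g) ⊚ nabla (arr g).

Record locally_subcartesian_closed := LocallySubcartesianClosed {
  pullback : forall (A B X : E) (f : hom A X) (g : hom B X), square f g;
  pullbackP : forall (A B X : E) (f : hom A X) (g : hom B X),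
    is_pullback (pullback f g);
  right_closed : forall (X : E) (g : slice X),
    right_adjoint (tensor_functor g) }.

Section Closed.
Variable K : locally_subcartesian_closed.

Section Delta.
Variables (X Y : E) (f : hom X Y).

Definition Delta_ob (h : slice Y) : slice X :=
  SliceOb (pr1 (pullback K f (arr h))).

Definition Delta_counit (h : slice Y) : hom (Sigma f (Delta_ob h)) h :=
  @SliceHom _ _ (Sigma f (Delta_ob h)) h (pr2 (pullback K f (arr h)))
    (eq_sym (squareP _)).

Lemma Delta_universal (h : slice X) (k : slice Y) (m : hom (Sigma f h) k) :
  exists! n : hom h (Delta_ob k), Delta_counit k ∘ fmap (Sigma f) n = m.
Proof.
have [u [[/= u1 u2] uu]] :=
  pullbackP K (Square (eq_sym (shomP m)) : square f (arr k)).
exists (@SliceHom _ _ h (Delta_ob k) u u1); split.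
  exact: slice_hom_eq.
move=> n e; apply: slice_hom_eq; apply: uu; split; first exact: (shomP n).
exact: (f_equal (@shom _ _ _ _) e).
Qed.

(* Pullback along [f], bundled with its adjunction to [Sigma f]. *)
Definition Delta : right_adjoint (Sigma f) := univ_right_adjoint Delta_universal.
End Delta.

(* A right adjoint to [nabla p], from a right adjoint R to (- ⊗_Y p): its value
   at m : M -> X is the pullback of R m : R(pm) -> R(p), where m is regarded as
   a map pm -> p over Y, along the map 1_Y -> R(p) corresponding to the
   projection 1_Y ⊗_Y p -> p. *)
Section Boxtimes.
Variables (X Y : E) (p : hom X Y).

Let P : slice Y := SliceOb p.
Let one : slice Y := SliceOb (idm Y).
Let T := tensor_functor P.
Let R := right_closed K P.
Let a := radjP R.

Definition box_to (m : slice X) : hom (Sigma p m) P :=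
  @SliceHom _ _ (Sigma p m) P (arr m) (eq_refl _).

Definition box_proj (h : slice Y) : hom (T h) P := box_to (nabla p h).

Definition box_bang (h : slice Y) : hom h one :=
  @SliceHom _ _ h one (arr h) (comp1m _).

Definition box_point : hom one (R P) := fmap R (box_proj one) ∘ unit a one.

Definition box_square (m : slice X) :
    square (shom (fmap R (box_to m))) (shom box_point) :=
  pullback K (shom (fmap R (box_to m))) (shom box_point).

Definition box_ob (m : slice X) : slice Y := SliceOb (pr2 (box_square m)).

Lemma box_incl_subproof (m : slice X) :
  arr (R (Sigma p m)) ∘ pr1 (box_square m) = pr2 (box_square m).
Proof.
rewrite -(shomP (fmap R (box_to m))) -compA squareP compA.
by rewrite (shomP box_point) comp1m.
Qed.

Definition box_incl (m : slice X) : hom (box_ob m) (R (Sigma p m)) :=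
  @SliceHom _ _ (box_ob m) (R (Sigma p m)) (pr1 (box_square m))
    (box_incl_subproof m).

Lemma box_inclP (m : slice X) :
  fmap R (box_to m) ∘ box_incl m = box_point ∘ box_bang (box_ob m).
Proof. by apply: slice_hom_eq; exact: squareP. Qed.

Lemma box_pointP (h : slice Y) :
  counit a P ∘ fmap T (box_point ∘ box_bang h) = box_proj h.
Proof.
rewrite /box_point fmapM compA fmapM compA -counit_natural.
rewrite -(compA (box_proj one)) triangle_l compm1.
apply: slice_hom_eq; exact: (shomP (fmap (nabla p) (box_bang h))).
Qed.

Lemma box_counit_subproof (m : slice X) :
  box_to m ∘ (counit a (Sigma p m) ∘ fmap T (box_incl m)) = box_proj (box_ob m).
Proof.
by rewrite compA counit_natural -compA -fmapM box_inclP box_pointP.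
Qed.

Definition box_counit (m : slice X) : hom (nabla p (box_ob m)) m :=
  @SliceHom _ _ (nabla p (box_ob m)) m
    (shom (counit a (Sigma p m) ∘ fmap T (box_incl m)))
    (f_equal (@shom _ _ _ _) (box_counit_subproof m)).

Lemma box_adj_inj (h : slice Y) (d : slice Y) (u v : hom h (R d)) :
  counit a d ∘ fmap T u = counit a d ∘ fmap T v -> u = v.
Proof.
move=> e.
have H w : fmap R (counit a d ∘ fmap T w) ∘ unit a h = w.
  by rewrite fmapM -compA unit_natural compA triangle_r comp1m.
by rewrite -(H u) -(H v) e.
Qed.

Lemma box_universal (h : slice Y) (m : slice X) (k : hom (nabla p h) m) :
  exists! n : hom h (box_ob m), box_counit m ∘ fmap (nabla p) n = k.
Proof.
pose k' : hom (T h) (Sigma p m) := fmap (Sigma p) k.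
pose l : hom h (R (Sigma p m)) := fmap R k' ∘ unit a h.
have lE : counit a (Sigma p m) ∘ fmap T l = k'.
  by rewrite /l fmapM compA -counit_natural -compA triangle_l compm1.
have lP : fmap R (box_to m) ∘ l = box_point ∘ box_bang h.
  apply: box_adj_inj; rewrite box_pointP fmapM compA -counit_natural -compA lE.
  apply: slice_hom_eq; exact: (shomP k).
have [u [[/= u1 u2] uu]] :=
  pullbackP K (Square (f_equal (@shom _ _ _ _) lP)).
pose n : hom h (box_ob m) := @SliceHom _ _ h (box_ob m) u u2.
have nl : box_incl m ∘ n = l by exact: slice_hom_eq.
exists n; split.
  apply: slice_hom_eq.
  transitivity (shom (counit a (Sigma p m) ∘ fmap T (box_incl m ∘ n))).
    by rewrite fmapM (compA (counit a _) (fmap T (box_incl m)) (fmap T n)).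
  by rewrite nl lE.
move=> n' e; apply: slice_hom_eq; apply: uu; split; last exact: (shomP n').
suff nl' : box_incl m ∘ n' = l by exact: (f_equal (@shom _ _ _ _) nl').
apply: box_adj_inj; rewrite lE /k' -e (fmapM T).
rewrite (compA (counit a _) (fmap T (box_incl m)) (fmap T n')).
exact: slice_hom_eq.
Qed.

Definition boxtimes : right_adjoint (nabla p) := univ_right_adjoint box_universal.
End Boxtimes.

Section Transformations.
Variables (A B C T : E) (f : hom A T) (g : hom B T).
Variables (f' : hom C B) (g' : hom C A).

(* Writing h : M -> B, the apexes below are C ⊗_B M and A ⊗_T M. *)
Definition is_canonical (b : nat_trans (Sigma g' ⊚ nabla f') (nabla f ⊚ Sigma g)) :
    Prop :=
  forall h : slice B,
    unique (fun m : hom (apex (chosen S f' (arr h))) (apex (chosen S f (g ∘ arr h))) =>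
        pr1 (chosen S f (g ∘ arr h)) ∘ m = g' ∘ pr1 (chosen S f' (arr h)) /\
        pr2 (chosen S f (g ∘ arr h)) ∘ m = pr2 (chosen S f' (arr h)))
      (shom (b h)).

(* The mate of b under Sigma ⊣ Delta and nabla ⊣ boxtimes, computed with the
   composite adjunctions nabla f ⊚ Sigma g ⊣ Delta g ⊚ boxtimes f and
   Sigma g' ⊚ nabla f' ⊣ boxtimes f' ⊚ Delta g'. *)
Definition transformation_t (b : nat_trans (Sigma g' ⊚ nabla f') (nabla f ⊚ Sigma g)) :
    nat_trans (Delta g ⊚ boxtimes f) (boxtimes f' ⊚ Delta g') :=
  mate (adj_comp (radjP (Delta g)) (radjP (boxtimes f)))
       (adj_comp (radjP (boxtimes f')) (radjP (Delta g'))) b.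
End Transformations.

End Closed.
End LocallySubcartesian.

(* Main.v *)
From Corelib Require Import ssreflect.
From Stdlib Require Import ClassicalEpsilon FunctionalExtensionality.
Require Import Defs.

(** Taking mates reflects and preserves invertibility, so [t] is invertible
    exactly when every component C ⊗_B M -> A ⊗_T M of [b] is.  By the binary
    axiom A ⊗_T M ≅ (A ⊗_T B) ⊗_B M, and the component at M is the base change of
    the comparison map u : C -> A ⊗_T B; it is invertible if u is, and at M = B
    it is u itself, up to isomorphism. *)

Set Implicit Arguments.
Unset Strict Implicit.
Unset Printing Implicit Defensive.

Local Open Scope cat_scope.

(** * Isomorphisms of objects and of squares *)

Section Isomorphisms.
Variable E : category.

Lemma is_iso_comp (X Y Z : E) (g : hom Y Z) (f : hom X Y) :
  is_iso g -> is_iso f -> is_iso (g ∘ f).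
Proof.
move=> [g' [g1 g2]] [f' [f1 f2]]; exists (f' ∘ g'); split.
- by rewrite -compA (compA g') g1 comp1m.
- by rewrite -compA (compA f) f2 comp1m.
Qed.

Lemma split_epi_mono_iso (X Y : E) (f : hom X Y) (g : hom Y X) :
  f ∘ g = idm Y ->
  (forall (W : E) (m n : hom W X), f ∘ m = f ∘ n -> m = n) -> is_iso f.
Proof.
move=> fg mono; exists g; split=> //.
by apply: mono; rewrite compA fg comp1m compm1.
Qed.

Lemma is_identity_is_iso (X Y : E) (f : hom X Y) : is_identity f -> is_iso f.
Proof. by case=> Z; exists (idm Z); rewrite comp1m. Qed.

Lemma square_iso_sym (A B X : E) (f : hom A X) (g : hom B X) (s t : square f g) :
  square_iso s t -> square_iso t s.
Proof.
move=> [u [[v [vu uv]] [u1 u2]]]; exists v; split; first by exists u.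
by split; rewrite -?u1 -?u2 -compA uv compm1.
Qed.

End Isomorphisms.

(** * Mates under a pair of adjunctions *)

Section NaturalTransformations.
Variables C D : category.

Lemma nat_trans_eq (F G : functor C D) (s t : nat_trans F G) :
  (forall c, s c = t c) -> s = t.
Proof.
case: s => s Ps; case: t => t Pt /= e.
have st : s = t by exact: functional_extensionality_dep.
by subst t; rewrite (proof_irrelevance _ Ps Pt).
Qed.

Lemma invertible_components (F G : functor C D) (t : nat_trans F G) :
  (forall c, is_iso (t c)) -> invertible t.
Proof.
move=> iso_t.
(* [is_iso] asserts mere existence, so a family of inverses has to be chosen; its naturality is then
   automatic. *)
pose s c := proj1_sig (constructive_indefinite_description _ (iso_t c)).
have sP c : s c ∘ t c = idm (F c) /\ t c ∘ s c = idm (G c).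
  exact: (proj2_sig (constructive_indefinite_description _ (iso_t c))).
have natural_s (c c' : C) (f : hom c c') : fmap F f ∘ s c = s c' ∘ fmap G f.
  rewrite -[LHS]comp1m -(proj1 (sP c')) -compA (compA (t c')) -nt_natural.
  by rewrite -compA (proj2 (sP c)) compm1.
by exists (NatTrans natural_s).
Qed.

Section Transposition.
Variables (L : functor C D) (R : functor D C) (a : adjunction L R).

Lemma unit_transpose_inj (c : C) (d : D) (u v : hom (L c) d) :
  fmap R u ∘ unit a c = fmap R v ∘ unit a c -> u = v.
Proof.
move=> e.
have H w : counit a d ∘ fmap L (fmap R w ∘ unit a c) = w.
  by rewrite fmapM compA -counit_natural -compA triangle_l compm1.
by rewrite -(H u) -(H v) e.
Qed.

Lemma counit_transpose_inj (c : C) (d : D) (u v : hom c (R d)) :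
  counit a d ∘ fmap L u = counit a d ∘ fmap L v -> u = v.
Proof.
move=> e.
have H w : fmap R (counit a d ∘ fmap L w) ∘ unit a c = w.
  by rewrite fmapM -compA unit_natural compA triangle_r comp1m.
by rewrite -(H u) -(H v) e.
Qed.

End Transposition.

(** Identifies the mate at [d] as the transpose under [a'] of [counit a d ∘ b (R d)], so that
    equations between mates can be checked after transposing. *)
Lemma mate_counit (L L' : functor C D) (R R' : functor D C)
    (a : adjunction L R) (a' : adjunction L' R') (b : nat_trans L' L) (d : D) :
  counit a' d ∘ fmap L' (mate a a' b d) = counit a d ∘ b (R d).
Proof.
rewrite /= compA -fmapM fmapM compA -counit_natural -compA.
by rewrite triangle_l compm1.
Qed.

(** The dual description, which recovers [b] from its mate. *)
Lemma mate_unit (L L' : functor C D) (R R' : functor D C)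
    (a : adjunction L R) (a' : adjunction L' R') (b : nat_trans L' L) (c : C) :
  mate a a' b (L c) ∘ unit a c = fmap R' (b c) ∘ unit a' c.
Proof.
rewrite /= -!compA -unit_natural (compA (fmap R' (b _))) -fmapM -nt_natural.
by rewrite compA -fmapM compA triangle_l comp1m.
Qed.

(** An inverse of [b] has a mate in the opposite direction, which inverts the mate of [b].
    Conversely, transposing back an inverse of the mate inverts each component of [b]. *)
Lemma invertible_mate (L L' : functor C D) (R R' : functor D C)
    (a : adjunction L R) (a' : adjunction L' R') (b : nat_trans L' L) :
  invertible (mate a a' b) <-> invertible b.
Proof.
split.
- move=> [s st]; apply: invertible_components => c.
  (* The component at [c] of the transformation whose mate is [s]. *)
  pose b' : hom (L c) (L' c) :=
    counit a (L' c) ∘ fmap L (s (L' c) ∘ unit a' c).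
  have b'E : fmap R b' ∘ unit a c = s (L' c) ∘ unit a' c.
    by rewrite /b' fmapM -compA unit_natural compA triangle_r comp1m.
  exists b'; split.
  + apply: (unit_transpose_inj (a := a')).
    rewrite fmapM -compA -(mate_unit a a') compA nt_natural.
    by rewrite -compA b'E compA (proj2 (st _)) fmap1.
  + apply: (unit_transpose_inj (a := a)).
    rewrite fmapM -compA b'E compA nt_natural -compA.
    by rewrite -(mate_unit a a') compA (proj1 (st _)) fmap1.
- move=> [b' bb']; exists (mate a' a b') => d; split.
  + apply: (counit_transpose_inj (a := a)).
    rewrite fmapM compA mate_counit -compA -nt_natural compA mate_counit.
    by rewrite -compA (proj2 (bb' _)) fmap1.
  + apply: (counit_transpose_inj (a := a')).
    rewrite fmapM compA mate_counit -compA -nt_natural compA mate_counit.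
    by rewrite -compA (proj1 (bb' _)) fmap1.
Qed.

End NaturalTransformations.

Lemma slice_is_iso (E : category) (X : E) (h k : slice X) (m : hom h k) :
  is_iso m <-> is_iso (shom m).
Proof.
split.
- move=> [n [nm mn]]; exists (shom n); split.
  + exact: (f_equal (@shom _ _ _ _) nm).
  + exact: (f_equal (@shom _ _ _ _) mn).
- move=> [n [nm mn]].
  have nP : arr h ∘ n = arr k by rewrite -(shomP m) -compA mn compm1.
  by exists (@SliceHom _ _ k h n nP); split; apply: slice_hom_eq.
Qed.

(** * Chosen subpullbacks: isomorphisms, base change, associativity *)

Section Subpullbacks.
Variables (E : category) (S : locally_subcartesian E).

Lemma chosen_idm_pr2 (A X : E) (g : hom A X) :
  is_iso (pr2 (chosen S (idm X) g)).
Proof.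
have [s [iso_s [_ /= <-]]] := chosen_symmetry S (idm X) g.
apply: is_iso_comp => //; apply: is_identity_is_iso.
apply: chosen_nullary; exact: is_identity_idm.
Qed.

(** With [v] inverse to [u], the binary axiom factors the second projection for [u ∘ v = idm X], an
    isomorphism, through the one for [u], which is therefore split epi. It is also monic: as [u] is
    invertible, it determines the first projection. *)
Lemma chosen_iso_pr2 (A B X : E) (u : hom A X) (g : hom B X) :
  is_iso u -> is_iso (pr2 (chosen S u g)).
Proof.
move=> [v [vu uv]].
have [j [_ ij]] : is_iso (pr2 (chosen S (u ∘ v) g)).
  by rewrite uv; exact: chosen_idm_pr2.
have [i [_ [_ /= i2]]] :=
  square_iso_sym (chosen_binary S v u g).
apply: (split_epi_mono_iso
  (g := pr2 (chosen S v (pr1 (chosen S u g))) ∘ (i ∘ j))).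
  by rewrite !compA i2.
move=> W m n e; apply: (@chosen_subcartesian _ S) => //.
have H w : pr1 (chosen S u g) ∘ w = v ∘ (g ∘ (pr2 (chosen S u g) ∘ w)).
  by rewrite (compA g) -squareP !compA vu comp1m.
by rewrite (H W m) (H W n) e.
Qed.

(** The binary axiom presents A ⊗_X B as A ⊗_{A'} (A' ⊗_X B), and [m] is the second projection from
    there. *)
Lemma chosen_base_change (A A' B X : E) (p : hom A' X) (u : hom A A')
    (h : hom B X) :
  exists m : hom (apex (chosen S (p ∘ u) h)) (apex (chosen S p h)),
    (is_iso u -> is_iso m) /\
    pr1 (chosen S p h) ∘ m = u ∘ pr1 (chosen S (p ∘ u) h) /\
    pr2 (chosen S p h) ∘ m = pr2 (chosen S (p ∘ u) h).
Proof.
have [i [ii [/= i1 i2]]] :=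
  square_iso_sym (chosen_binary S u p h).
exists (pr2 (chosen S u (pr1 (chosen S p h))) ∘ i); split.
  by move=> iu; apply: is_iso_comp => //; exact: chosen_iso_pr2.
by rewrite !compA -squareP -i1 -i2 !compA.
Qed.

(** The binary axiom pastes only along the first leg of a cospan, so symmetry is applied before and
    after it. *)
Lemma chosen_assoc (A B M X : E) (f : hom A X) (g : hom B X) (h : hom M B) :
  exists m : hom (apex (chosen S (pr2 (chosen S f g)) h))
                 (apex (chosen S f (g ∘ h))),
    is_iso m /\
    pr1 (chosen S f (g ∘ h)) ∘ m
      = pr1 (chosen S f g) ∘ pr1 (chosen S (pr2 (chosen S f g)) h) /\
    pr2 (chosen S f (g ∘ h)) ∘ m = pr2 (chosen S (pr2 (chosen S f g)) h).
Proof.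
have [s [[s' [s's ss']] [/= s1 s2]]] := chosen_symmetry S f g.
(* Base change along the symmetry [s] replaces [pr2 (chosen S f g)] by [pr1 (chosen S g f)], the leg
   that the binary axiom expects. *)
have [m [im [m1 m2]]] := chosen_base_change (pr1 (chosen S g f)) s h.
rewrite s2 in m m1 m2 im.
have [r [ir [/= r1 r2]]] := chosen_symmetry S (pr1 (chosen S g f)) h.
have [i [ii [/= i1 i2]]] := chosen_binary S h g f.
have [q [iq [/= q1 q2]]] := chosen_symmetry S (g ∘ h) f.
exists (q ∘ (i ∘ (r ∘ m))); split.
  do 3 apply: is_iso_comp => //; apply: im; by exists s'.
by rewrite !compA q1 q2 i1 i2 -(compA (pr2 (chosen S g f))) r1 r2
     -(compA _ (pr1 _)) m1 compA s1 m2.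
Qed.

(** Base change along [u] followed by associativity. This construction shows that the component
    inherits invertibility from [u]. *)
Lemma canonical_component (A B C T M : E) (f : hom A T) (g : hom B T)
    (u : hom C (apex (chosen S f g))) (f' : hom C B) (g' : hom C A)
    (u1 : pr1 (chosen S f g) ∘ u = g') (u2 : pr2 (chosen S f g) ∘ u = f')
    (h : hom M B) :
  exists m : hom (apex (chosen S f' h)) (apex (chosen S f (g ∘ h))),
    (is_iso u -> is_iso m) /\
    pr1 (chosen S f (g ∘ h)) ∘ m = g' ∘ pr1 (chosen S f' h) /\
    pr2 (chosen S f (g ∘ h)) ∘ m = pr2 (chosen S f' h).
Proof.
subst f' g'.
have [m [im [m1 m2]]] := chosen_base_change (pr2 (chosen S f g)) u h.
have [n [iN [n1 n2]]] := chosen_assoc f g h.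
exists (n ∘ m); split.
  by move=> iu; apply: is_iso_comp => //; exact: im.
by rewrite !compA n1 n2 -(compA _ (pr1 _)) m1 compA.
Qed.

(** * The canonical transformation [b] and its invertibility *)

Section Canonical.
Variables (A B C T : E) (f : hom A T) (g : hom B T).
Variables (f' : hom C B) (g' : hom C A) (comm : f ∘ g' = g ∘ f').

Lemma canonical_exists_unique :
  factors_through (Square comm) (chosen S f g) ->
  exists! b : nat_trans (Sigma g' ⊚ nabla S f') (nabla S f ⊚ Sigma g),
    is_canonical b.
Proof.
move=> [u [/= u1 u2]].
have ex (h : slice B) :
    exists! m : hom (apex (chosen S f' (arr h))) (apex (chosen S f (g ∘ arr h))),
      pr1 (chosen S f (g ∘ arr h)) ∘ m = g' ∘ pr1 (chosen S f' (arr h)) /\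
      pr2 (chosen S f (g ∘ arr h)) ∘ m = pr2 (chosen S f' (arr h)).
  have [m [_ [m1 m2]]] := canonical_component u1 u2 (arr h).
  exists m; split=> // n [n1 n2].
  by apply: (@chosen_subcartesian _ S); rewrite ?m1 ?m2.
pose b0 (h : slice B) :
    hom ((Sigma g' ⊚ nabla S f') h) ((nabla S f ⊚ Sigma g) h) :=
  @SliceHom _ _ (Sigma g' (nabla S f' h)) (nabla S f (Sigma g h))
    (the (ex h)) (proj1 (theP (ex h))).
(* Both sides have the same projections to A and to the domain of [k], and these are jointly
   monic. *)
have natural_b (h k : slice B) (m : hom h k) :
    fmap (nabla S f ⊚ Sigma g) m ∘ b0 h = b0 k ∘ fmap (Sigma g' ⊚ nabla S f') m.
  apply: slice_hom_eq => /=.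
  have [n1 n2] := theP (nabla_map_ex S f (fmap (Sigma g) m)).
  have [l1 l2] := theP (nabla_map_ex S f' m).
  have [h1 h2] := theP (ex h); have [k1 k2] := theP (ex k).
  apply: (@chosen_subcartesian _ S); first by rewrite !compA n1 k1 -compA l1 h1.
  by rewrite !compA n2 k2 l2 /= -compA h2.
exists (NatTrans natural_b); split.
- move=> h; split=> /=; first exact: (theP (ex h)).
  by move=> m mP; rewrite (the_eq (ex h) mP).
- move=> b bP; apply: nat_trans_eq => h; apply: slice_hom_eq => /=; symmetry.
  exact: (the_eq (ex h) (proj1 (bP h))).
Qed.

Lemma canonical_invertible
    (b : nat_trans (Sigma g' ⊚ nabla S f') (nabla S f ⊚ Sigma g)) :
  is_canonical b -> invertible b <-> is_subpullback S (Square comm).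
Proof.
move=> bP; split.
- move=> [s sb].
  have : is_iso (shom (b (SliceOb (idm B)))).
    by apply/slice_is_iso; exists (s (SliceOb (idm B))); exact: sb.
  have [[/=]] := bP (SliceOb (idm B)).
  (* The component is generalized first because its type mentions [g ∘ idm B], which is to become
     [g]. *)
  move: (shom _) => /=; rewrite compm1 => m m1 m2 _ im.
  have [j [ji ij]] : is_iso (pr1 (chosen S f' (idm B))).
    by apply: is_identity_is_iso; apply: chosen_nullary; exact: is_identity_idm.
  (* By the nullary axiom C ⊗_B B is C, with [j] inverse to the projection; so [m ∘ j] is the
     comparison map C -> A ⊗_T B. *)
  exists (m ∘ j); split.
    by apply: is_iso_comp => //; exists (pr1 (chosen S f' (idm B))).
  split=> /=; first by rewrite compA m1 -compA ij compm1.
  by rewrite compA m2 -(comp1m (pr2 _)) -squareP -compA ij compm1.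
- move=> [u [iu [/= u1 u2]]]; apply: invertible_components => h; apply/slice_is_iso.
  have [m [im mP]] := canonical_component u1 u2 (arr h).
  (* Uniqueness in [is_canonical] identifies the component of [b] with the explicit [m]. *)
  by rewrite (proj2 (bP h) m mP); exact: im.
Qed.

End Canonical.
End Subpullbacks.

Theorem corollary4p3p5 (E : category) (S : locally_subcartesian E)
    (K : locally_subcartesian_closed S) (A B C T : E)
    (f' : hom C B) (g' : hom C A) (g : hom B T) (f : hom A T)
    (comm : f ∘ g' = g ∘ f')
    (fact : factors_through (Square comm) (chosen S f g)) :
  (exists! b : nat_trans (Sigma g' ⊚ nabla S f') (nabla S f ⊚ Sigma g),
     is_canonical b) /\
  (forall b : nat_trans (Sigma g' ⊚ nabla S f') (nabla S f ⊚ Sigma g),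
     is_canonical b ->
     (invertible (transformation_t K b) <-> is_subpullback S (Square comm))).
Proof.
split; first exact: (canonical_exists_unique fact).
move=> b bP; rewrite -(canonical_invertible comm bP).
(* [transformation_t] is by definition a mate under the two composite adjunctions. *)
exact: invertible_mate.
Qed.
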